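(* Let $\mathcal{L}$ be a complete compact modular lattice and let $\mathfrak{m}$ be a submonoid with zero of $\mathrm{End}_{lin}(\mathcal{L})$ that is closed under complements. The following conditions are equivalent: (a) $\mathcal{L}$ is von Neumann regular. (b) $\mathcal{L}$ is dual-$\mathfrak{m}$-Rickart, and every compact element of $\mathcal{L}$ is $\mathfrak{m}$-$\mathcal{L}$-generated.
   Context: $\mathbf{0},\mathbf{1}$ denote the least and greatest elements; $[a,b]=\{x: a\le x\le b\}$. An element $x$ ''is a complement'' (or ''has a complement'') if there is $x'$ with $x\wedge x'=\mathbf{0}$, $x\vee x'=\mathbf{1}$. Linear morphism: a map $\varphi:\mathcal{L}\to\mathcal{L}'$ between bounded lattices is linear if there exist $\ker_\varphi\in\mathcal{L}$ and $a'\in\mathcal{L}'$ such that (1) $\varphi(x)=\varphi(x\vee\ker_\varphi)$ for all $x$; (2) $\varphi$ restricts to a lattice isomorphism $[\ker_\varphi,\mathbf{1}]\to[\mathbf{0},a']$ (so $a'=\varphi(\mathbf{1})$). $\mathrm{End}_{lin}(\mathcal{L})$ is the monoid of linear morphisms $\mathcal{L}\to\mathcal{L}$ under composition; its zero is the constant map $\mathbf{0}$. A submonoid with zero contains the identity and the zero morphism. For $x$ with complement $x'$, the projection $\pi_x$ (with respect to $x'$) is $\pi_x(a)=(a\vee x')\wedge x$, viewed with codomain $\mathcal{L}$ or $[\mathbf{0},x]$; $\iota_x:[\mathbf{0},x]\to\mathcal{L}$ is the inclusion. $\mathfrak{m}$ is closed under complements if for every $\varphi\in\mathfrak{m}$ and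 all $x,y$ having complements in $\mathcal{L}$ such that $\varphi$ restricts to an isomorphism $\varphi|_x:[\mathbf{0},x]\to[\mathbf{0},y]$, one has $\iota_x(\varphi|_x)^{-1}\pi_y\in\mathfrak{m}$ (for every choice of complement of $y$ defining $\pi_y$). A complete lattice $\mathcal{L}$ is compact if whenever $\mathbf{1}=\bigvee_{i\in I}a_i$ there is a finite $F\subseteq I$ with $\mathbf{1}=\bigvee_{i\in F}a_i$. An element $c$ is compact if $[\mathbf{0},c]$ is a compact lattice. A complete lattice is von Neumann regular if every compact element has a complement. $\mathcal{L}$ is dual-$\mathfrak{m}$-Rickart if $\varphi(\mathbf{1})$ has a complement for all $\varphi\in\mathfrak{m}$. An element $a\in\mathcal{L}$ is $\mathfrak{m}$-$\mathcal{L}$-generated if there is a family of linear morphisms $\{\varphi_i:\mathcal{L}\to[\mathbf{0},a]\}_{i\in I}$ with $\iota_a\varphi_i\in\mathfrak{m}$ for all $i$ and $\bigvee_{i\in I}\varphi_i(\mathbf{1})=a$. *)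

(* Defs.v *)
From HB Require Import structures.
From mathcomp Require Import all_boot all_order.
From mathcomp Require Import boolp classical_sets functions cardinality.

Set Implicit Arguments.
Unset Strict Implicit.
Unset Printing Implicit Defensive.

Import Order.TTheory.
Local Open Scope classical_set_scope.
Local Open Scope order_scope.

(* The proof of a <= b is carried by the type, so that every [segment ab] has
   canonical bounds; least and greatest elements are a and b. *)
Record segment d (L : latticeType d) (a b : L) (ab : a <= b) := Segment {
  segment_val :> L;
  _ : a <= segment_val <= b }.

Section SegmentLattice.
Context d (L : latticeType d) (a b : L) (ab : a <= b).

HB.instance Definition _ := [isSub for @segment_val d L a b ab].
HB.instance Definition _ := [Choice of segment ab by <:].

Let meet_itv : meet_closed [pred z : L | a <= z <= b].
Proof.
move=> x y; rewrite !inE => /andP[ax xb] /andP[ay _].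
by apply/andP; split; [rewrite lexI ax ay | exact: le_trans (leIl x y) xb].
Qed.

Let join_itv : join_closed [pred z : L | a <= z <= b].
Proof.
move=> x y; rewrite !inE => /andP[ax xb] /andP[_ yb].
by apply/andP; split; [exact: le_trans ax (leUl x y) | rewrite leUx xb yb].
Qed.

HB.instance Definition _ := Order.SubChoice_isSubLattice.Build
  d L _ d (segment ab) meet_itv join_itv.

Definition segment_bot : segment ab :=
  @Segment d L a b ab a (introT andP (conj (lexx a) ab)).
Definition segment_top : segment ab :=
  @Segment d L a b ab b (introT andP (conj ab (lexx b))).

Let segment_ge0 (x : segment ab) : segment_bot <= x.
Proof. by rewrite -Order.le_val; case/andP: (valP x). Qed.

Let segment_le1 (x : segment ab) : x <= segment_top.
Proof. by rewrite -Order.le_val; case/andP: (valP x). Qed.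

HB.instance Definition _ := Order.hasBottom.Build d (segment ab) segment_ge0.
HB.instance Definition _ := Order.hasTop.Build d (segment ab) segment_le1.

End SegmentLattice.

Definition below d (L : tbLatticeType d) (a : L) : tbLatticeType d :=
  segment (le0x a).
Definition above d (L : tbLatticeType d) (a : L) : tbLatticeType d :=
  segment (lex1 a).

Definition modular_lattice d (L : latticeType d) :=
  forall a b c : L, a <= c -> a `|` (b `&` c) = (a `|` b) `&` c.

Definition complete_lattice d (L : tbLatticeType d) :=
  forall A : set L, supremums A !=set0 /\ infimums A !=set0.

Definition compact_lattice d (L : tbLatticeType d) :=
  forall (I : Type) (a : I -> L), supremums (range a) \top ->
    exists2 F : set I, finite_set F & supremums (a @` F) \top.

Definition compact_element d (L : tbLatticeType d) (c : L) :=
  compact_lattice (below c).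

Definition complement d (L : tbLatticeType d) (x x' : L) :=
  x `&` x' = \bot /\ x `|` x' = \top.

Definition has_complement d (L : tbLatticeType d) (x : L) :=
  exists x', complement x x'.

Definition von_neumann_regular d (L : tbLatticeType d) :=
  forall c : L, compact_element c -> has_complement c.

Definition lattice_iso d d' (L : latticeType d) (L' : latticeType d')
    (f : L -> L') :=
  [/\ bijective f, {morph f : x y / x `&` y} & {morph f : x y / x `|` y}].

Definition linear_morphism d d' (L : tbLatticeType d) (L' : tbLatticeType d')
    (phi : L -> L') :=
  exists (k : L) (a' : L'),
    (forall x, phi x = phi (x `|` k)) /\
    exists f : above k -> below a',
      (forall u, val (f u) = phi (val u)) /\ lattice_iso f.

Definition End_lin d (L : tbLatticeType d) : set (L -> L) :=
  [set phi | linear_morphism phi].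

Definition submonoid_with_zero d (L : tbLatticeType d) (m : set (L -> L)) :=
  [/\ m `<=` @End_lin d L, m idfun, m (fun=> \bot) &
      forall phi psi, m phi -> m psi -> m (phi \o psi)].

Fact proj_subproof d (L : tbLatticeType d) (x x' a : L) :
  \bot <= (a `|` x') `&` x <= x.
Proof. by rewrite le0x leIr. Qed.

(* Meant for x' a complement of x. *)
Definition proj d (L : tbLatticeType d) (x x' a : L) : below x :=
  Segment (le0x x) (proj_subproof x x' a).

(* f is the restriction of phi to [0, x] -> [0, y] and g is its inverse. *)
Definition closed_under_complements d (L : tbLatticeType d)
    (m : set (L -> L)) :=
  forall (phi : L -> L) (x y : L) (f : below x -> below y)
      (g : below y -> below x),
    m phi -> has_complement x -> has_complement y ->
    (forall u, val (f u) = phi (val u)) -> lattice_iso f ->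
    cancel f g -> cancel g f ->
    forall y', complement y y' -> m (fun a => val (g (proj y y' a))).

Definition dual_Rickart d (L : tbLatticeType d) (m : set (L -> L)) :=
  forall phi, m phi -> has_complement (phi \top).

Definition generated d (L : tbLatticeType d) (m : set (L -> L)) (a : L) :=
  exists (I : Type) (phi : I -> L -> below a),
    [/\ forall i, linear_morphism (phi i),
        forall i, m (fun x => val (phi i x)) &
        supremums (range (fun i => val (phi i \top))) a].

(* Main.v *)
Require Import Defs.
From mathcomp Require Import all_boot all_order.
From mathcomp Require Import classical_sets.
From mathcomp Require Import cardinality.

(** The proof follows the module-theoretic pattern: over a von Neumann regular
    ring, finitely generated means direct summand.

    From (a) to (b).  If [phi] is linear with kernel [k], then [phi \top] is
    the top of an interval isomorphic to [above k].  Compactness passes from a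
    lattice to its upper intervals and along isomorphisms
    ([compact_lattice_above], [compact_lattice_iso]), so [phi \top] is compact,
    hence complemented.  Moreover a compact [c] has a complement, and closure
    under complements, applied to the identity of [below c], puts the
    projection onto [c] into [m] ([proj_in]); by modularity this projection is
    linear ([linear_proj]), and alone it generates [c].

    From (b) to (a).  A compact [c] is a finite join of tops [phi_i \top] with
    [phi_i] in [m], so it is enough that [x `|` psi \top] is complemented
    whenever [x] is complemented and [psi] is in [m]
    ([has_complement_join_image]).  Let [x'] be a complement of [x] and push
    [psi] into [x'] along [x].  The composite is still in [m], so its value [z]
    at the top is complemented by the dual Rickart condition.  Modularity gives
    [x `|` psi \top = x `|` z], and since [z] lies below [x'], complements of
    [x] and [z] combine into one of their join ([complement_join]). *)

Set Implicit Arguments.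
Unset Strict Implicit.
Unset Printing Implicit Defensive.

Import Order.TTheory.
Local Open Scope classical_set_scope.
Local Open Scope order_scope.

(** * Order isomorphisms and suprema *)

Lemma lattice_iso_le d d' (L : latticeType d) (L' : latticeType d')
    (f : L -> L') : lattice_iso f -> {mono f : x y / x <= y}.
Proof.
case=> fbij fI _ x y; apply/idP/idP => [/meet_idPl|/meet_idPl xy].
  by rewrite -fI => /(bij_inj fbij)/meet_idPl.
by apply/meet_idPl; rewrite -fI xy.
Qed.

(** Meets and joins are determined by the order, so it suffices to check
    monotonicity of a bijection and of its inverse. *)
Lemma lattice_iso_of_homo d d' (L : latticeType d) (L' : latticeType d')
    (f : L -> L') (g : L' -> L) :
  cancel f g -> cancel g f -> {homo f : x y / x <= y} ->
  {homo g : x y / x <= y} -> lattice_iso f.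
Proof.
move=> fK gK f_homo g_homo; split; first by exists g.
- move=> x y; apply/le_anti; rewrite lexI !f_homo ?leIl ?leIr//=.
  rewrite -[X in X <= _]gK f_homo// lexI.
  by rewrite -[X in _ <= X]fK -[X in _ && (_ <= X)]fK !g_homo ?leIl ?leIr.
- move=> x y; apply/le_anti; rewrite leUx !f_homo ?leUl ?leUr//= andbT.
  rewrite -[X in _ <= X]gK f_homo// leUx.
  by rewrite -[X in X <= _]fK -[X in _ && (X <= _)]fK !g_homo ?leUl ?leUr.
Qed.

Lemma supremums_top d (L : tbLatticeType d) (A : set L) :
  supremums A \top <-> forall u, ubound A u -> u = \top.
Proof.
split=> [[_ Atop] u /Atop|Atop]; first by rewrite le1x => /eqP.
by split=> [x _|u /Atop ->//]; exact: lex1.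
Qed.

(** * Compactness *)

Lemma compact_lattice_iso d d' (L : tbLatticeType d) (L' : tbLatticeType d')
    (f : L -> L') : lattice_iso f -> compact_lattice L -> compact_lattice L'.
Proof.
move=> fiso cL I a /supremums_top atop.
have f_le := lattice_iso_le fiso; case: fiso => -[g fK gK] _ _.
have f_top : f \top = \top.
  by apply/le_anti; rewrite lex1/= -[X in X <= _]gK f_le lex1.
have [|F finF /supremums_top Ftop] := cL I (g \o a).
  apply/supremums_top => u ub_u; apply: (can_inj fK); rewrite f_top.
  by apply: atop => _ [i _ <-]; rewrite -[a i]gK f_le; apply: ub_u; exists i.
exists F => //; apply/supremums_top => u ub_u.
rewrite -[u]gK (Ftop (g u)) ?f_top// => _ [i Fi <-].
by rewrite -f_le !gK; apply: ub_u; exists i.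
Qed.

Lemma compact_lattice_above d (L : tbLatticeType d) (k : L) :
  compact_lattice L -> compact_lattice (above k).
Proof.
move=> cL I a /supremums_top atop.
have seg u : k <= u -> k <= u <= \top by move=> ->; rewrite lex1.
(* Adjoining k to the family makes its upper bounds in L lie above k; this
   matters only for the empty family, whose supremum is k in [above k]. *)
pose b (o : option I) : L := if o is Some i then val (a i) else k.
have [|F finF /supremums_top Ftop] := cL (option I) b.
  apply/supremums_top => u ub_u.
  have ku : k <= u by apply: (ub_u k); exists None.
  suff /(congr1 val) : (Segment (lex1 k) (seg u ku) : above k) = \top by [].
  apply: atop => _ [i _ <-]; rewrite -Order.le_val.
  by apply: (ub_u (b (Some i))); exists (Some i).
exists [set i | F (Some i)].
  by apply: (@finite_preimage _ _ F Some) => // i j _ _ [].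
apply/supremums_top => u ub_u; apply/val_inj => /=.
apply: (Ftop (val u)) => _ [[i|] Fi <-] /=; last by case/andP: (valP u).
by rewrite Order.le_val; apply: ub_u; exists i.
Qed.

Lemma compact_linear_image d d' (L : tbLatticeType d) (L' : tbLatticeType d')
    (phi : L -> L') :
  compact_lattice L -> linear_morphism phi -> compact_element (phi \top).
Proof.
move=> cL [k [a' [_ [f [phiE fiso]]]]].
suff -> : phi \top = a'.
  exact: compact_lattice_iso fiso (@compact_lattice_above _ L k cL).
have f_le := lattice_iso_le fiso; case: fiso => -[g _ gK] _ _.
rewrite -[\top]/(val (\top : above k)) -phiE.
suff -> : f \top = \top by [].
by apply/le_anti; rewrite lex1/= -[X in X <= _]gK f_le lex1.
Qed.

(** * Complements in modular lattices *)

Lemma complementC d (L : tbLatticeType d) (x x' : L) :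
  complement x x' -> complement x' x.
Proof. by case; rewrite meetC joinC. Qed.

(** The part [z' `&` x'] of [z'] inside [x'] is a complement of [z] relative
    to [x'], and therefore one of [x `|` z] in the whole lattice. *)
Lemma complement_join d (L : tbLatticeType d) (x x' z z' : L) :
  modular_lattice L -> complement x x' -> complement z z' -> z <= x' ->
  complement (x `|` z) (z' `&` x').
Proof.
move=> modL [xI xU] [zI zU] zx'; split.
  rewrite [z' `&` x']meetC meetA [x `|` z]joinC -modL// xI joinx0; exact: zI.
by rewrite -joinA modL// zU meet1x.
Qed.

(** The projection factors through [a |-> a `|` x'], so its kernel is [x'], and
    on [above x'] it is the diamond isomorphism onto [below x], whose inverse
    [v |-> v `|` x'] is where modularity enters. *)
Lemma linear_proj d (L : tbLatticeType d) (x x' : L) :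
  modular_lattice L -> complement x x' ->
  linear_morphism (proj x x' : L -> below x).
Proof.
move=> modL [xI xU]; exists x', \top; split.
  by move=> a; apply/val_inj; rewrite /= -joinA joinxx.
have f_subproof u : \bot <= proj x x' u <= (\top : below x).
  by rewrite le0x lex1.
pose f (u : above x') : below (\top : below x) :=
  Segment (le0x (\top : below x)) (f_subproof (val u)).
have g_subproof (v : L) : x' <= v `|` x' <= \top by rewrite leUr lex1.
pose g (v : below (\top : below x)) : above x' :=
  Segment (lex1 x') (g_subproof (val (val v))).
exists f; split=> //; apply: (@lattice_iso_of_homo _ _ _ _ f g).
- move=> u; apply/val_inj => /=; have /andP[x'u _] := valP u.
  by rewrite (join_idPl x'u) meetC joinC modL// [x' `|` x]joinC xU meet1x.
- move=> v; do 2!apply/val_inj => /=; have /andP[_ vx] := valP (val v).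
  by rewrite -joinA joinxx -modL// [x' `&` x]meetC xI joinx0.
- by move=> u v uv; rewrite -!Order.le_val/= leI2// leU2.
- by move=> u v uv; rewrite -!Order.le_val/= leU2.
Qed.

(** * Projections in [m] and joins of images *)

Lemma proj_in d (L : tbLatticeType d) (m : set (L -> L)) (x x' : L) :
  m idfun -> closed_under_complements m -> complement x x' ->
  m (fun a => val (proj x x' a)).
Proof.
move=> m_id m_closed xx'; have cx : has_complement x by exists x'.
apply: (m_closed idfun x x id id) => //.
by split=> //; exists id.
Qed.

(** Since [x `|` y = x `|` z] for the projection [z] of [y = psi \top] onto a
    complement of [x], the element [y] may be replaced by [z], which is
    independent of [x] and still the value at the top of a map in [m]. *)
Lemma has_complement_join_image d (L : tbLatticeType d) (m : set (L -> L))
    (x : L) (psi : L -> L) :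
  modular_lattice L -> submonoid_with_zero m -> closed_under_complements m ->
  dual_Rickart m -> has_complement x -> m psi ->
  has_complement (x `|` psi \top).
Proof.
move=> modL [_ m_id _ m_comp] m_closed rick [x' xx'] m_psi.
have m_proj := proj_in m_id m_closed (complementC xx').
have [z' zz'] := rick _ (m_comp _ _ m_proj m_psi).
exists (z' `&` x').
suff -> : x `|` psi \top = x `|` (psi \top `|` x) `&` x'.
  by apply: complement_join => //; exact: leIr.
rewrite [_ `&` x']meetC modL ?leUr//.
by rewrite (proj2 xx') meet1x joinC.
Qed.

Lemma has_complement_join_images d (L : tbLatticeType d) (m : set (L -> L))
    (s : seq L) :
  modular_lattice L -> submonoid_with_zero m -> closed_under_complements m ->
  dual_Rickart m -> (forall y, y \in s -> exists2 psi, m psi & y = psi \top) ->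
  has_complement (\join_(y <- s) y).
Proof.
move=> modL m_sub m_closed rick; elim: s => [_|y s IHs s_img].
  by rewrite big_nil; exists \top; split; rewrite ?meet0x ?join0x.
rewrite big_cons joinC.
have [|psi m_psi ->] := s_img y; first by rewrite mem_head.
apply: (has_complement_join_image modL m_sub m_closed rick) => //.
apply: IHs => z zs; by apply: s_img; rewrite inE zs orbT.
Qed.

Theorem proposition3p20 (d : Order.disp_t) (L : tbLatticeType d)
    (m : set (L -> L))
    (Lcomplete : complete_lattice L) (Lcompact : compact_lattice L)
    (Lmodular : modular_lattice L)
    (m_submonoid : submonoid_with_zero m)
    (m_closed : closed_under_complements m) :
  von_neumann_regular L <->
  (dual_Rickart m /\ forall c : L, compact_element c -> generated m c).
Proof.
have [m_lin m_id _ _] := m_submonoid.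
split=> [vnr|[rick gen] c c_compact].
  split=> [phi /m_lin phi_lin|c /vnr[c' cc']].
    exact/vnr/(compact_linear_image Lcompact phi_lin).
  exists unit, (fun=> proj c c'); split=> [_|_|].
  - exact: linear_proj.
  - exact: proj_in.
  - have pc : val (proj c c' \top) = c by rewrite /= join1x meet1x.
    by split=> [_ [_ _ <-]|u ub_u]; [|apply: ub_u; exists tt]; rewrite ?pc.
have [I [phi [_ m_phi [_ phi_sup]]]] := gen c c_compact.
have [|F finF /supremums_top Ftop] := c_compact I (fun i => phi i \top).
  apply/supremums_top => u ub_u; apply/le_anti; rewrite lex1/= -Order.le_val.
  by apply: phi_sup => _ [i _ <-]; rewrite Order.le_val; apply: ub_u; exists i.
have /finite_seqP[s sE] := finite_image (fun i => val (phi i \top)) finF.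
have mem_s y : y \in s <-> exists2 i, F i & val (phi i \top) = y.
  by have := congr1 (@^~ y) sE; rewrite /= /image/= => ->.
have sc : \bot <= \join_(y <- s) y <= c.
  rewrite le0x/=; apply/joinsP_seq => y /mem_s[i _ <-] _.
  by case/andP: (valP (phi i \top)).
suff <- : \join_(y <- s) y = c.
  apply: (has_complement_join_images Lmodular m_submonoid m_closed rick).
  by move=> y /mem_s[i _ <-]; exists (fun x => val (phi i x)).
suff /(congr1 val) : (Segment (le0x c) sc : below c) = \top by [].
apply: Ftop => _ [i Fi <-]; rewrite -Order.le_val/=.
have : val (phi i \top) \in s by apply/mem_s; exists i.
by move/(joins_sup_seq (P := predT) id); exact.
Qed.
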